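(* Let $\sigma>0$ and $f\in G_\sigma$. Under the interpolation conditions described in the context (with $b_0>0$ any positive number), for any fixed $\delta$, $0<\delta\le b_0$, the optimal choice of $\beta$ in the interval $(0,\beta_0]$, where $$\beta_0=\frac{1}{144\sqrt2\,e\,b_0^{3/2}\sqrt\delta},$$ is the number minimizing $$MN(\beta):=\beta^{\frac{b_0}{2\delta}}\left\{\sup_{\xi\in R^n}e^{\frac{|\xi|^2}{4\beta}-\frac{|\xi|^3}{\sigma}}\right\}^{1/2},\qquad \beta\in(0,\beta_0].$$
   Context: $n\ge1$ is the dimension, $\rho=\sqrt3/e$, and $\alpha_n$ is the volume of the unit ball in $R^n$. $G_\sigma=\{f\in L^2(R^n):\int|\hat f(\xi)|^2e^{|\xi|^3/\sigma}d\xi<\infty\}$ with $\|f\|_{G_\sigma}=\left\{\int|\hat f(\xi)|^2e^{|\xi|^3/\sigma}d\xi\right\}^{1/2}$, where $\hat f$ denotes the Fourier transform of $f$. Interpolation conditions: $h(x)=e^{-\beta|x|^2}$, $x\in R^n$, $\beta>0$, is the Gaussian with shape parameter $\beta$. The $h$ spline interpolating $f$ on $X=\{x_1,\dots,x_N\}\subset R^n$ is $s(x)=\sum_{j=1}^Nc_jh(x-x_j)$ with $s(x_i)=f(x_i)$ for $i=1,\dots,N$. For an $n$-simplex in $R^n$ with vertices $v_1,\dots,v_{n+1}$, the evenly spaced points of degree $l$ are the points $\sum_{i=1}^{n+1}\frac{k_i}{l}v_i$ with nonnegative integers $k_i$, $\sum_{i=1}^{n+1} k_i=l$. The point $x$ lies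 in a set $\Omega\subseteq R^n$ with the property that for any $x\in\Omega$ and any number $r$ with $\frac{b_0}{2}\le r\le b_0$ there is an $n$-simplex $Q$ of diameter $r$ with $x\in Q\subseteq\Omega$ such that for any integer $l$ with $\frac{b_0}{\delta}\le l\le\frac{2b_0}{\delta}$ there is on $Q$ an evenly spaced set of centers from $X$ of degree $l-1$. (If $x\in\Omega$ is fixed, it is only required that there be one such simplex $Q$, with diameter $r$ and $x\in Q\subseteq\Omega$, having this property of evenly spaced centers, and the centers of $s$ are just the evenly spaced points in $Q$.) Moreover $0<\delta\le\delta_0$, where $$\delta_0=\min\left\{b_0,\ \frac{1}{\rho_3^4\cdot3^3\cdot2^7\cdot b_0^3}\right\},\qquad \rho_3=12^{1/4}\sqrt{e\beta};$$ this condition is equivalent to $\delta\le b_0$ together with $\beta\le\beta_0$. Under these conditions $$|f(x)-s(x)|\le c_1\sqrt\delta\,(c_2\delta)^{c_3/\delta}\frac{1}{(2\pi)^{n}}\left\{\sup_{\xi\in R^n}e^{\frac{|\xi|^2}{4\beta}-\frac{|\xi|^3}{\sigma}}\right\}^{1/2}\|f\|_{G_\sigma},$$ where $c_1=\frac{\Delta''}{\sqrt{16\pi}\sqrt{b_0}}$, $c_2=\rho_3^4\cdot3^3\cdot2^7\cdot b_0^3$, $c_3=\frac{b_0}{4}$, $\Delta''=\sqrt{2+\frac1e}\,\pi^{\frac{n-1}{4}}(n\alpha_n)^{1/2}2^{\frac n4}\rho^{\frac{n-1}{4}}$ for odd $n$ and $\Delta''=\pi^{\frac{n-1}{4}}(n\alpha_n)^{1/2}2^{\frac{n+1}{4}}\rho^{\frac{n-2}{4}}$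 for even $n$. ''Optimal'' means that the right-hand side of this error bound, as a function of $\beta$, is minimal. *)

(* Defs.v *)
From HB Require Import structures.
From mathcomp Require Import all_boot all_order all_algebra.
From mathcomp Require Import complex.
From mathcomp Require Import all_classical all_reals all_analysis.

Set Implicit Arguments.
Unset Strict Implicit.
Unset Printing Implicit Defensive.

Import Order.TTheory GRing.Theory Num.Theory.
Import numFieldNormedType.Exports.

Local Open Scope classical_set_scope.
Local Open Scope complex_scope.
Local Open Scope ring_scope.

(* Points of R^n are row vectors. They carry the product Borel sigma-algebra,
   generated by the coordinate maps. *)

Definition rV_display : measure_display. Proof. exact: default_measure_display. Qed.

Section rV_measurable.
Context {R : realType} (n : nat).

Definition rV_coord (i : 'I_n) (x : 'rV[R]_n) : measurableTypeR R := x 0 i.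

Let rV_set0 : g_sigma_preimage rV_coord set0.
Proof. exact: sigma_algebra0. Qed.

Let rV_setC A : g_sigma_preimage rV_coord A -> g_sigma_preimage rV_coord (~` A).
Proof. exact: sigma_algebraC. Qed.

Let rV_bigcup (F : _^nat) : (forall i, g_sigma_preimage rV_coord (F i)) ->
  g_sigma_preimage rV_coord (\bigcup_i (F i)).
Proof. exact: sigma_algebra_bigcup. Qed.

HB.instance Definition _ := @isMeasurable.Build rV_display
  'rV[R]_n (g_sigma_preimage rV_coord) rV_set0 rV_setC rV_bigcup.

Lemma measurable_rV_coord (i : 'I_n) : measurable_fun [set: 'rV[R]_n] (rV_coord i).
Proof.
move=> _ Y mY; rewrite setTI; apply: sub_sigma_algebra => /=.
rewrite -bigcup_seq/=; exists i => /=; first by rewrite mem_index_enum.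
by exists Y => //; rewrite setTI.
Qed.

Lemma measurable_fun_rV d (T : measurableType d) (f : T -> 'rV[R]_n) :
  (forall i, measurable_fun [set: T] (rV_coord i \o f)) ->
  measurable_fun [set: T] f.
Proof.
move=> mf _ A mA; rewrite setTI.
pose F := image_set_system setT f measurable.
suff : g_sigma_preimage rV_coord `<=` F.
  by move=> /(_ A mA); rewrite /F /image_set_system /= setTI.
apply: smallest_sub.
  exact/sigma_algebra_image/sigma_algebra_measurable.
rewrite -bigcup_seq; apply: bigcup_sub => i _ B [C mC <-].
rewrite /F /image_set_system /= !setTI -comp_preimage -[X in measurable X]setTI.
exact: mf.
Qed.

End rV_measurable.

Section lebesgue_step.
Context {R : realType} (n : nat).

Definition rV_cons (p : measurableTypeR R * 'rV[R]_n) : 'rV[R]_n.+1 :=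
  \row_i (if unlift ord0 i is Some j then p.2 0 j else p.1).

Definition rV_uncons (x : 'rV[R]_n.+1) : measurableTypeR R * 'rV[R]_n :=
  (x 0 ord0, \row_j x 0 (lift ord0 j)).

Lemma rV_consK : cancel rV_cons rV_uncons.
Proof.
move=> [a y]; congr pair; first by rewrite mxE unlift_none.
by apply/rowP => j; rewrite !mxE liftK.
Qed.

Lemma rV_unconsK : cancel rV_uncons rV_cons.
Proof.
by move=> x; apply/rowP => i; rewrite mxE; case: unliftP => [j ->|->]; rewrite ?mxE.
Qed.

Lemma measurable_rV_cons : measurable_fun setT rV_cons.
Proof.
apply: measurable_fun_rV => i; case: (unliftP ord0 i) => [j ->|->].
  rewrite (_ : _ \o _ = rV_coord j \o snd); last first.
    by apply/funext => p /=; rewrite /rV_coord mxE liftK.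
  by apply: measurableT_comp => //; exact: measurable_rV_coord.
rewrite (_ : _ \o _ = fst) //.
by apply/funext => p /=; rewrite /rV_coord mxE unlift_none.
Qed.

Lemma measurable_rV_uncons : measurable_fun setT rV_uncons.
Proof.
apply: measurable_fun_pair; first exact: measurable_rV_coord.
apply: measurable_fun_rV => j.
rewrite (_ : _ \o _ = rV_coord (lift ord0 j)); first exact: measurable_rV_coord.
by apply/funext => x /=; rewrite /rV_coord mxE.
Qed.

Variable mu : {sigma_finite_measure set 'rV[R]_n -> \bar R}.

Definition lebesgue_step : set 'rV[R]_n.+1 -> \bar R :=
  pushforward (lebesgue_measure \x mu)%E rV_cons.

Let measurable_preimage_cons A : measurable A -> measurable (rV_cons @^-1` A).
Proof. by move=> mA; rewrite -[X in measurable X]setTI; exact: measurable_rV_cons. Qed.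

Let lebesgue_step0 : lebesgue_step set0 = 0%E.
Proof. by rewrite /lebesgue_step /pushforward preimage_set0 measure0. Qed.

Let lebesgue_step_ge0 A : (0 <= lebesgue_step A)%E.
Proof. by rewrite /lebesgue_step /pushforward measure_ge0. Qed.

Let lebesgue_step_sigma_additive : semi_sigma_additive lebesgue_step.
Proof.
move=> F mF tF mUF; rewrite /lebesgue_step /pushforward preimage_bigcup.
apply: measure_semi_sigma_additive.
- by move=> k; exact: measurable_preimage_cons.
- apply/trivIsetP => /= i j _ _ ij; rewrite -preimage_setI.
  by move/trivIsetP : tF => /(_ _ _ _ _ ij) ->//; rewrite preimage_set0.
- by rewrite -preimage_bigcup; exact: measurable_preimage_cons.
Qed.

HB.instance Definition _ := isMeasure.Build _ _ _ lebesgue_step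
  lebesgue_step0 lebesgue_step_ge0 lebesgue_step_sigma_additive.

Let lebesgue_step_sigma_finite : sigma_finite setT lebesgue_step.
Proof.
pose m1 : {sigma_finite_measure set (measurableTypeR R) -> \bar R} := lebesgue_measure.
have /sigma_finiteP[F [TF ndF Foo]] := sigma_finiteT m1.
have /sigma_finiteP[G [TG ndG Goo]] := sigma_finiteT mu.
exists (fun k => rV_uncons @^-1` (F k `*` G k)).
  apply/esym/seteqP; split=> // x _.
  have [i _ Fi] : (\bigcup_k F k) (rV_uncons x).1 by rewrite -TF.
  have [j _ Gj] : (\bigcup_k G k) (rV_uncons x).2 by rewrite -TG.
  exists (maxn i j) => //; split.
  - by move: Fi; exact/subsetPset/ndF/leq_maxl.
  - by move: Gj; exact/subsetPset/ndG/leq_maxr.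
move=> k; have [mF Fk] := Foo k; have [mG Gk] := Goo k.
have mFG : measurable (F k `*` G k) by exact: measurableX.
split; first by rewrite -[X in measurable X]setTI; exact: measurable_rV_uncons.
rewrite /lebesgue_step /pushforward -comp_preimage.
rewrite (_ : rV_uncons \o rV_cons = id); last by apply/funext => p; exact: rV_consK.
rewrite preimage_id product_measure1E//.
by rewrite lte_mul_pinfty// ge0_fin_numE.
Qed.

HB.instance Definition _ := Measure_isSigmaFinite.Build _ _ _ lebesgue_step
  lebesgue_step_sigma_finite.

End lebesgue_step.

Fixpoint lebesgue_rV {R : realType} (n : nat) :
    {sigma_finite_measure set 'rV[R]_n -> \bar R} :=
  match n with
  | 0 => \d_(0 : 'rV[R]_0)
  | m.+1 => lebesgue_step (lebesgue_rV m)
  end.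

Lemma lebesgue_rV_box {R : realType} (n : nat) (A : 'I_n -> set (measurableTypeR R)) :
  (forall i, measurable (A i)) ->
  lebesgue_rV n [set x : 'rV[R]_n | forall i, A i (x 0 i)] =
  (\prod_(i < n) lebesgue_measure (A i))%E.
Proof.
elim: n A => [|n IH] A mA.
  by rewrite big_ord0 /= diracE mem_set// => -[].
rewrite big_ord_recl /= /lebesgue_step /pushforward.
rewrite (_ : _ @^-1` _ =
  A ord0 `*` [set y : 'rV[R]_n | forall i, A (lift ord0 i) (y 0 i)]).
  rewrite product_measure1E//.
    congr (_ * _)%E; exact: (IH (fun i => A (lift ord0 i))).
  rewrite (_ : mkset _ = \bigcap_(i in [set: 'I_n]) (rV_coord i @^-1` A (lift ord0 i))).
    apply: fin_bigcap_measurable => // i _.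
    by rewrite -[X in measurable X]setTI; exact: measurable_rV_coord.
  by apply/seteqP; split => [y /= h i _|y h i]; exact: h.
apply/seteqP; split => [[a y] /= h|[a y] /= [h0 h] i].
  split=> [|i /=]; first by have := h ord0; rewrite mxE unlift_none.
  by have := h (lift ord0 i); rewrite mxE liftK.
by rewrite mxE; case: unliftP => [j ->|->].
Qed.

Section fourier.
Context {R : realType} (n : nat).
Implicit Types (x y xi : 'rV[R]_n) (f g : 'rV[R]_n -> R[i]).

(* The norm carried by 'rV[R]_n in the library is the sup norm. *)
Definition enorm x : R := Num.sqrt (\sum_(i < n) x 0 i ^+ 2).

Definition dotprod x y : R := \sum_(i < n) x 0 i * y 0 i.

Definition cmod (z : R[i]) : R := ComplexField.Normc.normc z.

Definition sqnorm_L2 f : \bar R :=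
  (\int[lebesgue_rV n]_x (cmod (f x) ^+ 2)%:E)%E.

Definition cmeasurable f : Prop :=
  measurable_fun setT (fun x => complex.Re (f x)) /\
  measurable_fun setT (fun x => complex.Im (f x)).

Definition L2 : set ('rV[R]_n -> R[i]) :=
  [set f | cmeasurable f /\ (sqnorm_L2 f < +oo)%E].

Definition cintegral (D : set 'rV[R]_n) f : R[i] :=
  (\int[lebesgue_rV n]_(x in D) complex.Re (f x)) +i*
  (\int[lebesgue_rV n]_(x in D) complex.Im (f x)).

(* e^{i t} *)
Definition expi (t : R) : R[i] := cos t +i* sin t.

Definition fourier_trunc f (r : R) : 'rV[R]_n -> R[i] := fun xi =>
  cintegral [set x | enorm x <= r] (fun x => f x * expi (- dotprod x xi)).

(* Fourier-Plancherel transform on L^2, for the convention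
   f^(xi) = int f(x) e^{-i x.xi} dx: the L^2 limit of the integrals over the
   balls of radius k. *)
Definition is_fourier f g : Prop :=
  L2 g /\
  (fun k : nat => sqnorm_L2 (fun xi => fourier_trunc f k%:R xi - g xi))
    @ \oo --> 0%E.

(* Determined up to a null set for f in L^2. *)
Definition fourier f : 'rV[R]_n -> R[i] := xget (fun=> 0) [set g | is_fourier f g].

Definition sqnorm_G (sigma : R) f : \bar R :=
  (\int[lebesgue_rV n]_xi
    (cmod (fourier f xi) ^+ 2 * expR (enorm xi ^+ 3 / sigma))%:E)%E.

Definition spaceG (sigma : R) : set ('rV[R]_n -> R[i]) :=
  [set f | L2 f /\ (sqnorm_G sigma f < +oo)%E].

Definition norm_G (sigma : R) f : R := Num.sqrt (fine (sqnorm_G sigma f)).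

End fourier.

Section interpolation.
Context {R : realType} (n : nat).
Implicit Types (x : 'rV[R]_n) (v : 'I_n.+1 -> 'rV[R]_n) (delta beta : R).

Definition gaussian beta x : R := expR (- beta * enorm x ^+ 2).

Definition h_spline beta N (X : 'I_N -> 'rV[R]_n) (f s : 'rV[R]_n -> R[i]) : Prop :=
  (exists c : 'I_N -> R[i],
     forall x, s x = \sum_(j < N) c j * (gaussian beta (x - X j))%:C) /\
  (forall i, s (X i) = f (X i)).

Definition affinely_independent v : Prop :=
  forall a : 'I_n.+1 -> R,
    \sum_i a i = 0 -> \sum_i a i *: v i = 0 -> forall i, a i = 0.

Definition simplex v : set 'rV[R]_n :=
  [set x | exists a : 'I_n.+1 -> R,
    [/\ forall i, 0 <= a i, \sum_i a i = 1 & x = \sum_i a i *: v i]].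

Definition diameter (Q : set 'rV[R]_n) : R :=
  sup [set d | exists x y, [/\ Q x, Q y & d = enorm (x - y)]].

Definition evenly_spaced (l : nat) v : set 'rV[R]_n :=
  [set x | exists k : 'I_n.+1 -> nat,
    (\sum_i k i)%N = l /\ x = \sum_i ((k i)%:R / l%:R) *: v i].

(* The grids have degree l - 1; degree 0, where k_i / 0 has no meaning, is left
   out. It could only occur for delta = b0. *)
Definition admissible (b0 : R) delta (l : nat) : Prop :=
  (1 < l)%N /\ b0 / delta <= l%:R <= 2 * b0 / delta.

Definition simplex_at (b0 : R) delta (Omega C : set 'rV[R]_n) x (r : R) v : Prop :=
  [/\ affinely_independent v, diameter (simplex v) = r,
      simplex v x, simplex v `<=` Omega
    & forall l, admissible b0 delta l -> evenly_spaced l.-1 v `<=` C].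

(* C is the set of centers. The second alternative is the version for a fixed
   x, where a single simplex is needed and the centers are its grid points. *)
Definition centers_condition (b0 : R) delta (Omega C : set 'rV[R]_n) x : Prop :=
  Omega x /\
  ((forall y, Omega y -> forall r, b0 / 2 <= r <= b0 ->
      exists v, simplex_at b0 delta Omega C y r v)
   \/
   (exists r v, [/\ b0 / 2 <= r <= b0, simplex_at b0 delta Omega C x r v
      & C = \bigcup_(l in admissible b0 delta) evenly_spaced l.-1 v])).

Definition rho3 beta : R := 12%:R `^ (1 / 4) * Num.sqrt (expR 1 * beta).

Definition c2 (b0 : R) beta : R := rho3 beta ^+ 4 * 3 ^+ 3 * 2 ^+ 7 * b0 ^+ 3.

Definition delta0 (b0 : R) beta : R :=
  Num.min b0 (1 / (rho3 beta ^+ 4 * 3 ^+ 3 * 2 ^+ 7 * b0 ^+ 3)).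

Definition interpolation_conditions (b0 : R) delta beta (Omega : set 'rV[R]_n) x
    N (X : 'I_N -> 'rV[R]_n) (f s : 'rV[R]_n -> R[i]) : Prop :=
  [/\ 0 < delta <= delta0 b0 beta,
      centers_condition b0 delta Omega (range X) x
    & h_spline beta X f s].

End interpolation.

Section error_bound.
Context {R : realType} (n : nat).
Implicit Types (sigma delta beta : R).

Definition beta0 (b0 : R) delta : R :=
  1 / (144 * Num.sqrt 2 * expR 1 * b0 `^ (3 / 2) * Num.sqrt delta).

Definition alpha : R := fine (lebesgue_rV n [set x : 'rV[R]_n | enorm x <= 1]).

Definition rho : R := Num.sqrt 3 / expR 1.

Definition Delta'' : R :=
  if odd n then
    Num.sqrt (2 + 1 / expR 1) * pi `^ ((n%:R - 1) / 4) * Num.sqrt (n%:R * alpha)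
      * 2 `^ (n%:R / 4) * rho `^ ((n%:R - 1) / 4)
  else
    pi `^ ((n%:R - 1) / 4) * Num.sqrt (n%:R * alpha)
      * 2 `^ ((n%:R + 1) / 4) * rho `^ ((n%:R - 2) / 4).

Definition c1 (b0 : R) : R := Delta'' / (Num.sqrt (16 * pi) * Num.sqrt b0).

Definition c3 (b0 : R) : R := b0 / 4.

Definition sup_factor sigma beta : R :=
  sup [set expR (enorm xi ^+ 2 / (4 * beta) - enorm xi ^+ 3 / sigma)
      | xi in [set: 'rV[R]_n]].

Definition error_bound sigma (f : 'rV[R]_n -> R[i]) (b0 : R) delta beta : R :=
  c1 b0 * Num.sqrt delta * (c2 b0 beta * delta) `^ (c3 b0 / delta)
    * (1 / (2 * pi) ^+ n) * Num.sqrt (sup_factor sigma beta) * norm_G sigma f.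

Definition MN sigma (b0 : R) delta beta : R :=
  beta `^ (b0 / (2 * delta)) * Num.sqrt (sup_factor sigma beta).

End error_bound.

Definition minimizes {R : realType} (F : R -> R) (A : set R) (b : R) : Prop :=
  A b /\ forall b', A b' -> F b <= F b'.

(* Optimality refers to the right-hand side of the error bound. *)
Definition optimal {R : realType} (n : nat) (sigma : R) (f : 'rV[R]_n -> R[i])
    (b0 delta : R) (A : set R) (beta : R) : Prop :=
  minimizes (error_bound sigma f b0 delta) A beta.

(* Main.v *)
(** Since [c2 b0 beta] is proportional to [beta ^+ 2], the error bound is
    [MN beta] times a constant independent of [beta], and that constant is
    positive when [norm_G sigma f] is nonzero. Maximizing over [|xi|] gives
    [MN beta = expR (p * ln beta + K / beta ^+ 3)] with [p = b0 / (2 * delta)]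
    and [K = (sigma / 12) ^+ 2 / 6]. The exponent is strictly convex in [ln beta], with
    critical point [beta ^+ 3 = 3 * K / p]: the unique minimizer is the smaller of
    this point and [beta0]. *)
Require Import Defs.
From mathcomp Require Import all_boot all_order all_algebra.
From mathcomp Require Import complex.
From mathcomp Require Import all_classical all_reals all_analysis.
From mathcomp Require Import ring lra.
Import Order.TTheory GRing.Theory Num.Theory.
Import numFieldNormedType.Exports.
Local Open Scope classical_set_scope.
Local Open Scope complex_scope.
Local Open Scope ring_scope.

Lemma enorm_ge0 (R : realType) (n : nat) (x : 'rV[R]_n) : 0 <= enorm x.
Proof. exact: sqrtr_ge0. Qed.

Lemma enorm_le1 (R : realType) (n : nat) (x : 'rV[R]_n) :
  (enorm x <= 1) = (\sum_(i < n) x 0 i ^+ 2 <= 1).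
Proof. by rewrite /enorm -{1}(@sqrtr1 R) ler_sqrt. Qed.

(** The exponent in [sup_factor] depends on [xi] only through [enorm xi]; this supplies a vector at
    the maximizing radius. *)
Lemma exists_enorm (R : realType) (n : nat) (r : R) :
  (0 < n)%N -> 0 <= r -> exists x : 'rV[R]_n, enorm x = r.
Proof.
case: n => // n _ r0; exists (\row_j (if j == ord0 then r else 0)).
rewrite /enorm big_ord_recl big1 => [|i _]; last by rewrite mxE expr0n.
by rewrite mxE eqxx addr0 sqrtr_sqr ger0_norm.
Qed.

Lemma measurable_rV_box (R : realType) (n : nat) (A : 'I_n -> set (measurableTypeR R)) :
  (forall i, measurable (A i)) ->
  measurable [set x : 'rV[R]_n | forall i, A i (x 0 i)].
Proof.
move=> mA.
rewrite (_ : mkset _ = \bigcap_(i in [set: 'I_n]) (rV_coord i @^-1` A i)).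
  apply: fin_bigcap_measurable => // i _.
  by rewrite -[X in measurable X]setTI; exact: measurable_rV_coord.
by apply/seteqP; split => [y /= h i _|y h i]; exact: h.
Qed.

Lemma measurable_unit_ball (R : realType) (n : nat) :
  measurable [set x : 'rV[R]_n | enorm x <= 1].
Proof.
pose g (x : 'rV[R]_n) : R := \sum_(i < n) x 0 i ^+ 2.
have mg : measurable_fun setT g.
  apply: measurable_sum => i; apply: measurable_realfun.measurable_funX.
  exact: (measurable_rV_coord i).
rewrite (_ : mkset _ = setT `&` g @^-1` `]-oo, 1]); first exact: mg.
by rewrite setTI; apply/seteqP; split=> x /=; rewrite enorm_le1 in_itv.
Qed.

Lemma lebesgue_rV_cube (R : realType) (n : nat) (a b : R) : a <= b ->
  lebesgue_rV n [set x : 'rV[R]_n | forall i, `[a, b]%classic (x 0 i)] = ((b - a) ^+ n)%:E.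
Proof.
move=> ab; rewrite (lebesgue_rV_box (A := fun=> `[a, b]%classic)) //.
rewrite (eq_bigr (fun=> (b - a)%:E)) => [|i _].
  by rewrite prodEFin prodr_const card_ord.
rewrite lebesgue_measure_itv /= lte_fin; case: ltP => // ba.
by rewrite (@le_anti _ _ a b) ?ab ?ba // subrr.
Qed.

(** Since [fine] sends [+oo] to 0, the volume must be shown both nonzero and finite: the ball lies
    between the cubes [[0, 1/n]^n], where [x_i^2 <= x_i <= 1/n], and [[-1, 1]^n]. *)
Lemma alpha_gt0 (R : realType) (n : nat) : (0 < n)%N -> 0 < @alpha R n.
Proof.
move=> n0; have n0' : 0 < n%:R :> R by rewrite ltr0n.
apply: fine_gt0; apply/andP; split.
- have n1 : 0 <= n%:R^-1 :> R by rewrite invr_ge0 ltW.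
  apply: (@lt_le_trans _ _ (((n%:R^-1 - 0) ^+ n : R)%:E)).
    by rewrite lte_fin exprn_gt0// subr0 invr_gt0.
  rewrite -(lebesgue_rV_cube R n _ _ n1); apply: le_measure; rewrite ?inE.
  + by apply: (measurable_rV_box R n (fun=> `[0, n%:R^-1]%classic)) => i; exact: measurable_itv.
  + exact: measurable_unit_ball.
  move=> x /= xn; rewrite enorm_le1.
  apply: (@le_trans _ _ (\sum_(i < n) n%:R^-1)); last first.
    by rewrite sumr_const card_ord -[_ *+ n]mulr_natl divff ?gt_eqF.
  apply: ler_sum => i _; have := xn i; rewrite in_itv /= => /andP[x0 x1].
  have n_le1 : n%:R^-1 <= 1 :> R by rewrite invf_le1 // ler1n.
  by rewrite (le_trans _ x1)// expr2 ler_piMl// (le_trans x1).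
- have ab : -1 <= 1 :> R by rewrite (le_trans (lerN10 _)).
  apply: (@le_lt_trans _ _ (((1 - -1) ^+ n : R)%:E)); last exact: ltry.
  rewrite -(lebesgue_rV_cube R n _ _ ab); apply: le_measure; rewrite ?inE.
  + exact: measurable_unit_ball.
  + by apply: (measurable_rV_box R n (fun=> `[-1, 1]%classic)) => i; exact: measurable_itv.
  move=> x /=; rewrite enorm_le1 => x1 i; rewrite in_itv /= -ler_norml.
  rewrite -(@expr_le1 _ 2)// real_normK ?num_real// (le_trans _ x1)//.
  by rewrite (bigD1 i)//= lerDl; apply: sumr_ge0 => j _; exact: sqr_ge0.
Qed.

Lemma Delta''_gt0 (R : realType) (n : nat) : (0 < n)%N -> 0 < @Delta'' R n.
Proof.
move=> n0; have a0 := @alpha_gt0 R n n0.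
have rho0 : 0 < @rho R by rewrite divr_gt0 ?sqrtr_gt0 ?expR_gt0.
have na0 : 0 < n%:R * @alpha R n by rewrite mulr_gt0 ?ltr0n.
have e0 : 0 < 2 + 1 / expR 1 :> R by rewrite addr_gt0 ?divr_gt0 ?expR_gt0.
by rewrite /Delta''; case: ifP => _; rewrite !mulr_gt0 ?powR_gt0 ?sqrtr_gt0 ?pi_gt0.
Qed.

Lemma sup_max (R : realType) (E : set R) (m : R) : E m -> ubound E m -> sup E = m.
Proof.
move=> Em ubm; apply/le_anti/andP; split; first by apply: ge_sup => //; exists m.
by apply: ub_le_sup => //; exists m.
Qed.

(* The exponent is maximal at |xi| = sigma / (6 beta). *)
Lemma sup_factorE (R : realType) (n : nat) (sigma beta : R) :
  (0 < n)%N -> 0 < sigma -> 0 < beta ->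
  sup_factor n sigma beta = expR ((sigma / 12) ^+ 2 / 3 / beta ^+ 3).
Proof.
move=> n0 s0 b0; have bN0 := lt0r_neq0 b0; have sN0 := lt0r_neq0 s0.
apply: sup_max.
  have [|xi xiE] := @exists_enorm R n (sigma / (6 * beta)) n0.
    by rewrite ltW// divr_gt0// mulr_gt0.
  by exists xi => //; rewrite xiE; congr expR; field; rewrite sN0 bN0.
move=> _ [xi _ <-]; rewrite ler_expR -subr_ge0.
(* [u] is the ratio of [|xi|] to the maximizing radius; the gap to the maximum is a positive
   multiple of [1 - 3 u^2 + 2 u^3 = (1 - u)^2 (1 + 2 u)]. *)
set t := enorm xi; pose u := 6 * beta * t / sigma.
rewrite (_ : _ - _ = (sigma / 12) ^+ 2 / 3 / beta ^+ 3 * (1 - u) ^+ 2 * (1 + 2 * u)).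
  have u0 : 0 <= u by rewrite divr_ge0 ?mulr_ge0 ?enorm_ge0 ?(ltW b0) ?(ltW s0).
  have b3 : 0 <= beta ^+ 3 by rewrite exprn_ge0// ltW.
  apply: mulr_ge0; last by rewrite addr_ge0// mulr_ge0.
  by rewrite mulr_ge0 ?sqr_ge0// divr_ge0// divr_ge0// sqr_ge0.
by rewrite /u; field; rewrite sN0 bN0.
Qed.

Lemma sqrt_expR (R : realType) (a : R) : Num.sqrt (expR a) = expR (a / 2).
Proof.
rewrite (_ : expR a = expR (a / 2) ^+ 2) ?sqrtr_sqr ?ger0_norm ?expR_ge0//.
by rewrite expr2 -expRD; congr expR; field.
Qed.

Lemma MNE (R : realType) (n : nat) (sigma b0 delta beta : R) :
  (0 < n)%N -> 0 < sigma -> 0 < beta ->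
  MN n sigma b0 delta beta =
  expR (b0 / (2 * delta) * ln beta + (sigma / 12) ^+ 2 / 6 / beta ^+ 3).
Proof.
move=> n0 s0 beta_gt0; rewrite /MN sup_factorE// sqrt_expR /powR gt_eqF// -expRD.
by congr (expR (_ + _)); field; rewrite gt_eqF.
Qed.

(** [beta] enters only through [rho3 beta ^+ 4], which contains [Num.sqrt beta ^+ 4]. *)
Lemma c2E (R : realType) (b0 beta : R) : 0 <= beta ->
  c2 b0 beta = c2 b0 1 * beta ^+ 2.
Proof.
move=> beta0; rewrite /c2 /rho3 mulr1 sqrtrM ?expR_ge0//.
rewrite (_ : beta ^+ 2 = Num.sqrt beta ^+ 4); first ring.
by rewrite (exprM _ 2 2) sqr_sqrtr.
Qed.

Lemma c2_gt0 (R : realType) (b0 beta : R) : 0 < b0 -> 0 < beta -> 0 < c2 b0 beta.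
Proof.
move=> b00 beta0; have rho3_gt0 : 0 < rho3 beta.
  by rewrite mulr_gt0 ?powR_gt0 ?sqrtr_gt0 ?mulr_gt0 ?expR_gt0.
have b3 : 0 < b0 ^+ 3 by rewrite exprn_gt0.
apply: mulr_gt0 b3; rewrite -mulrA; apply: mulr_gt0; first by rewrite exprn_gt0.
by rewrite mulr_gt0 ?exprn_gt0.
Qed.

(** The part of the error bound free of [beta] and [f], with [c2 b0 1] as the coefficient of
    [beta ^+ 2] in [c2]. The factor [norm_G] stays apart because it may vanish. *)
Definition error_const (R : realType) (n : nat) (b0 delta : R) : R :=
  c1 n b0 * Num.sqrt delta * (c2 b0 1 * delta) `^ (c3 b0 / delta)
    * (1 / (2 * pi) ^+ n).

Lemma error_const_gt0 (R : realType) (n : nat) (b0 delta : R) :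
  (0 < n)%N -> 0 < b0 -> 0 < delta -> 0 < error_const R n b0 delta.
Proof.
move=> n0 b00 d0; rewrite /error_const !mulr_gt0//.
- exact: Delta''_gt0.
- by rewrite invr_gt0 mulr_gt0 ?sqrtr_gt0 ?mulr_gt0 ?pi_gt0.
- by rewrite sqrtr_gt0.
- by rewrite powR_gt0// mulr_gt0// c2_gt0.
- by rewrite invr_gt0 exprn_gt0// mulr_gt0 ?pi_gt0.
Qed.

Lemma error_boundE (R : realType) (n : nat) (sigma : R) (f : 'rV[R]_n -> R[i])
    (b0 delta beta : R) : 0 < b0 -> 0 < delta -> 0 < beta ->
  error_bound sigma f b0 delta beta =
  error_const R n b0 delta * norm_G sigma f * MN n sigma b0 delta beta.
Proof.
move=> b00 d0 beta0; rewrite /error_bound /error_const /MN c2E ?ltW//.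
(* The square doubles [c3 b0 / delta = b0 / (4 * delta)] to the exponent of [beta] in [MN]. *)
have -> : (c2 b0 1 * beta ^+ 2 * delta) `^ (c3 b0 / delta) =
    (c2 b0 1 * delta) `^ (c3 b0 / delta) * beta `^ (b0 / (2 * delta)).
  have cd : 0 <= c2 b0 1 * delta by rewrite mulr_ge0// ltW// c2_gt0.
  rewrite mulrAC (powRM _ cd (sqr_ge0 beta)).
  rewrite -(powR_mulrn 2 (ltW beta0)) -powRrM; congr (_ * _ `^ _).
  by rewrite /c3; field; rewrite gt_eqF.
ring.
Qed.

(* The first-order condition at [b], with the sign allowed at the right end
   point, suffices because the function is strictly convex in [ln b]. *)
Lemma ln_plus_inv_cube_lt (R : realType) (p K b b' : R) :
  0 < K -> 0 < b -> 0 < b' -> b' != b ->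
  0 <= (p - 3 * K / b ^+ 3) * (b' - b) ->
  p * ln b + K / b ^+ 3 < p * ln b' + K / b' ^+ 3.
Proof.
(* With [k = K / b ^+ 3] the difference of the two sides is [p v + k (exp (-3 v) - 1)]. As
   [exp (-3 v) > 1 - 3 v] for nonzero [v], it exceeds [(p - 3 k) v]. *)
move=> K0 bp b'p nb; pose v := ln b' - ln b.
have b'E : b' = b * expR v.
  by rewrite /v expRD expRN !lnK ?posrE// mulrC divfK ?gt_eqF.
have vN0 : v != 0.
  by apply: contra nb => /eqP v0; rewrite b'E v0 expR0 mulr1.
set c := p - _ => h.
(* [b' - b] and [v] have the same sign, so the hypothesis carries over to [v]. *)
have cv : 0 <= c * v.
  have [vlt|vgt|v0] := ltgtP v 0; last by rewrite v0 mulr0.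
  - have : b' - b < 0 by rewrite subr_lt0 b'E gtr_pMr// expR_lt1.
    by move=> lt0; move: h; rewrite (nmulr_lge0 _ lt0) (nmulr_lge0 _ vlt).
  - have : 0 < b' - b by rewrite subr_gt0 b'E ltr_pMr// expR_gt1.
    by move=> gt0; move: h; rewrite (pmulr_lge0 _ gt0) (pmulr_lge0 _ vgt).
have e3 : 1 + - 3 * v < expR (- 3 * v) by rewrite expR_gt1Dx// mulf_neq0// oppr_eq0.
have E3 : expR (- 3 * v) = (expR v ^+ 3)^-1 by rewrite -expRM_natl -expRN; congr expR; ring.
have k0 : 0 < K / b ^+ 3 by rewrite divr_gt0// exprn_gt0.
have -> : K / b' ^+ 3 = K / b ^+ 3 * expR (- 3 * v).
  by rewrite E3 b'E exprMn invfM mulrA.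
have -> : ln b' = ln b + v by rewrite /v addrC subrK.
have : K / b ^+ 3 * (1 + - 3 * v) < K / b ^+ 3 * expR (- 3 * v) by rewrite ltr_pM2l.
move: cv; rewrite /c -[3 * K / b ^+ 3]mulrA.
move: (K / b ^+ 3) (expR _) => k E; clear; lra.
Qed.

Lemma exists_strict_min_ln_plus_inv_cube (R : realType) (p K bmax : R) :
  0 < p -> 0 < K -> 0 < bmax ->
  exists2 b, 0 < b <= bmax & forall b', 0 < b' <= bmax -> b' != b ->
    p * ln b + K / b ^+ 3 < p * ln b' + K / b' ^+ 3.
Proof.
(* The critical point, written as the positive cube root of [3 * K / p]. *)
move=> p0 K0 m0; pose bs := expR (ln (3 * K / p) / 3).
have bs3 : bs ^+ 3 = 3 * K / p.
  rewrite /bs -expRM_natl mulrC divfK ?pnatr_eq0// lnK// posrE.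
  by rewrite divr_gt0// mulr_gt0.
have bs0 : 0 < bs by exact: expR_gt0.
have [le|lt] := leP bs bmax.
  exists bs; rewrite ?bs0// => b' /andP[b'0 _] nb.
  apply: ln_plus_inv_cube_lt => //; rewrite bs3.
  suff -> : p - 3 * K / (3 * K / p) = 0 by rewrite mul0r.
  by field; rewrite !gt_eqF.
(* The critical point lies beyond [bmax]: both [p - 3 * K / bmax ^+ 3] and [b' - bmax] are
   nonpositive, so their product is nonnegative. *)
exists bmax; rewrite ?m0 ?lexx// => b' /andP[b'0 b'm] nb.
apply: ln_plus_inv_cube_lt => //.
rewrite mulr_le0 ?subr_le0// ler_pdivlMr ?exprn_gt0//.
have : bmax ^+ 3 <= bs ^+ 3 by rewrite lerXn2r ?nnegrE ?ltW.
by rewrite bs3 ler_pdivlMr// mulrC.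
Qed.

Theorem mainTheorem4 (R : realType) (n : nat) (sigma : R)
    (f : 'rV[R]_n -> R[i]) (b0 delta : R)
    (Omega : set 'rV[R]_n) (x : 'rV[R]_n) (N : nat) (X : 'I_N -> 'rV[R]_n)
    (s : R -> 'rV[R]_n -> R[i]) :
  (1 <= n)%N ->
  0 < sigma ->
  spaceG sigma f ->
  0 < b0 ->
  0 < delta <= b0 ->
  injective X ->
  (forall beta : R, 0 < beta <= beta0 b0 delta ->
     interpolation_conditions b0 delta beta Omega x X f (s beta)) ->
  let B := [set beta : R | 0 < beta <= beta0 b0 delta] in
  [/\ exists! beta : R, minimizes (MN n sigma b0 delta) B beta,
      forall beta : R, minimizes (MN n sigma b0 delta) B beta ->
        optimal sigma f b0 delta B beta
    & norm_G sigma f != 0 ->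
      forall beta : R, optimal sigma f b0 delta B beta ->
        minimizes (MN n sigma b0 delta) B beta].
Proof.
move=> n0 s0 _ b00 /andP[d0 _] _ _ B.
have C0 := @error_const_gt0 R n b0 delta n0 b00 d0.
have G0 : 0 <= norm_G sigma f by exact: sqrtr_ge0.
have EB beta : B beta -> error_bound sigma f b0 delta beta =
    error_const R n b0 delta * norm_G sigma f * MN n sigma b0 delta beta.
  by move=> /andP[? _]; exact: error_boundE.
split.
- have [|||b Bb bmin] := @exists_strict_min_ln_plus_inv_cube R (b0 / (2 * delta))
    ((sigma / 12) ^+ 2 / 6) (beta0 b0 delta).
  + by rewrite divr_gt0// mulr_gt0.
  + by rewrite !(divr_gt0, exprn_gt0).
  + by rewrite divr_gt0// !mulr_gt0 ?sqrtr_gt0 ?expR_gt0 ?powR_gt0.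
  have MNlt b' : B b' -> b' != b -> MN n sigma b0 delta b < MN n sigma b0 delta b'.
    move=> Bb' nb; have [/andP[b_gt0 _] /andP[b'_gt0 _]] := (Bb, Bb').
    by rewrite !MNE// ltr_expR bmin.
  exists b; split.
    by split=> // b' Bb'; have [->|/(MNlt _ Bb')/ltW] := eqVneq b' b.
  move=> b' [Bb' b'min]; apply/eqP; rewrite eq_sym; apply: contraT => nb.
  by have := MNlt _ Bb' nb; rewrite ltNge b'min.
- move=> beta [Bbeta bmin]; split=> // b' Bb'.
  by rewrite !EB// ler_wpM2l ?bmin// mulr_ge0// ltW.
(* Cancelling the common factor requires it to be positive; if [norm_G sigma f] were 0, the bound
   would vanish on [B] and every point of [B] would be optimal. *)
- move=> GN0 beta [Bbeta bmin]; split=> // b' Bb'.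
  by have := bmin _ Bb'; rewrite !EB// ler_pM2l// mulr_gt0// lt_def GN0.
Qed.
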